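(* For $N\in[G_{n+1},G_{n+2})$ let $k(N)$ denote the number of nonzero digits in the legal decomposition of $N$. Let $g:{\cal L}\to\{0,1\}$ be defined by $g(x,j,j')=1$ if and only if $x>0$, and let $\tilde g=g-E_{\pi^Q}g$. Then, as $n\to\infty$: 1. (Generalized Lekkerkerker's Theorem) $$E^{Q_n}k(N)=C_{\rm Lek}(n+1)+d+o(1),$$ where $$C_{\rm Lek}=1-\pi^Q_1(0),\qquad d=E_{\tilde\varphi_c}(Q^{\#}g)+\frac{E_{\pi^Q}\left[g\,\left(Q^{\#}\tfrac{1}{\varphi_c}\right)\right]}{\|\nu_c\|_1}.$$ 2. (Variance) $$E^{Q_n}\left(k(N)-C_{\rm Lek}(n+1)\right)^2=(1+o(1))(n+1)\sigma^2,\qquad\text{where }\sigma^2=E_{\pi^Q}\left[\tilde g\,((2Q^{\#}-I)\tilde g)\right].$$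
   Context: $\mathbb{Z}_+=\{0,1,\dots\}$. Fix $L\in\mathbb{N}$ and $c_1,\dots,c_L\in\mathbb{Z}_+$ with $c_1c_L>0$ and $(L,c_1)\ne(1,1)$. The positive linear recursion $(G_n)_{n\ge1}$ is: $G_1=1$; $G_{n+1}=c_1G_n+c_2G_{n-1}+\dots+c_nG_1+1$ for $1\le n\le L-1$; $G_{n+1}=\sum_{j=1}^Lc_jG_{n+1-j}$ for $n\ge L$. An expression $N=\sum_{i=1}^na_iG_{n+1-i}$ with $a_1\in\mathbb{N}$, $a_2,\dots,a_n\in\mathbb{Z}_+$ is a legal decomposition of length $n$ if either (i) $n<L$ and $a_i=c_i$ for $1\le i\le n$; or (ii) there is $s\in\{1,\dots,L\}$ with $a_1=c_1,\dots,a_{s-1}=c_{s-1}$, $a_s<c_s$, $a_{s+1}=\dots=a_{s+\ell}=0$ for some $\ell\ge0$, and $(a_{s+\ell+i})_{i=1}^{n-s-\ell}$ is either (the digit sequence of) a legal decomposition or empty. It is known that every positive integer has a unique legal decomposition, and the integers in $[G_n,G_{n+1})$ are exactly those whose legal decomposition has length $n$. The $a_i$ are the digits. $Q_n$ ($n\in\mathbb{Z}_+$) denotes the uniform distribution on the integers $N\in[G_{n+1},G_{n+2})$ (those with $n+1$ digits), with expectation $E^{Q_n}$. Let $${\cal L}=\{(x,j,j'): (x<c_j \text{ and } j'=1)\text{ or }(j<L,\ x=c_j,\ j'=j+1)\},\qquad {\cal L}_0={\cal L}\cap\{(x,1,j'):x>0\},$$ with $x\in\{0,\dots,\max_ic_i\}$,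 $j,j'\in\{1,\dots,L\}$. $P_{\cal L}$ is the ${\cal L}\times{\cal L}$ matrix with entry $\frac{1}{(\max_ic_i+1)L}$ at $(z,z')$ if the third coordinate of $z$ equals the second coordinate of $z'$, and $0$ otherwise; it is irreducible and aperiodic. $\lambda_c$ is its Perron eigenvalue, with positive left and right eigenvectors $\nu_c,\varphi_c$ normalized so that $\varphi_c$ and $\nu_c\varphi_c$ are probability distributions on ${\cal L}$. $Q(z,z')=\frac{1}{\lambda_c\varphi_c(z)}P_{\cal L}(z,z')\varphi_c(z')$ is an irreducible aperiodic stochastic matrix with stationary distribution $\pi^Q=\nu_c\varphi_c$; $\pi^Q_1(x)=\sum_{b,b'}\pi^Q(x,b,b')$; $\tilde\varphi_c$ is $\varphi_c$ conditioned on ${\cal L}_0$; $\|\nu_c\|_1=\sum_z\nu_c(z)$. For a probability $m$ on ${\cal L}$, $E_mh=\sum_zm(z)h(z)$. $Q^{\#}$ is the inverse of $I-Q$ on $\{h:E_{\pi^Q}h=0\}$, extended linearly to all functions on ${\cal L}$ by $Q^{\#}\mathbf 1=0$; products of functions are pointwise. *)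

(* Defs.v *)
From mathcomp Require Import all_boot all_order all_algebra.
From mathcomp Require Import all_classical all_reals all_analysis.
From mathcomp.real_closed Require Import complex.

Set Implicit Arguments.
Unset Strict Implicit.
Unset Printing Implicit Defensive.

Import Order.TTheory GRing.Theory Num.Theory numFieldNormedType.Exports.

Local Open Scope classical_set_scope.
Local Open Scope ring_scope.

(** The coefficients are [c : nat -> nat]; only [c 1, ..., c L] are used. *)

Definition admissible (L : nat) (c : nat -> nat) : Prop :=
  [/\ (0 < L)%N, (0 < c 1 * c L)%N & (L, c 1) <> (1, 1)%N].

(** [G 0] is left free; it never occurs in the recursion. *)
Definition positive_linear_recursion (L : nat) (c G : nat -> nat) : Prop :=
  [/\ G 1 = 1%N,
      forall n : nat, (1 <= n <= L - 1)%N ->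
        G n.+1 = (\sum_(1 <= j < n.+1) c j * G (n.+1 - j) + 1)%N
    & forall n : nat, (L <= n)%N ->
        G n.+1 = (\sum_(1 <= j < L.+1) c j * G (n.+1 - j))%N].

(** [c_1, ..., c_n] *)
Definition prefix_digits (c : nat -> nat) (n : nat) : seq nat :=
  [seq c i | i <- iota 1 n].

(** The digit sequences [a_1, ..., a_n] of legal decompositions. In the
    last two constructors [x] is [a_s], and what follows the [l] zeros is empty,
    respectively legal. Positivity of the leading digit is required
    throughout. *)
Inductive legal (L : nat) (c : nat -> nat) : seq nat -> Prop :=
| legal_prefix (n : nat) :
    (0 < n < L)%N -> (0 < head 0 (prefix_digits c n))%N ->
    legal L c (prefix_digits c n)
| legal_last (s x l : nat) :
    (1 <= s <= L)%N -> (x < c s)%N ->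
    (0 < head 0 (prefix_digits c s.-1 ++ x :: nseq l 0))%N ->
    legal L c (prefix_digits c s.-1 ++ x :: nseq l 0%N)
| legal_cons (s x l : nat) (b : seq nat) :
    (1 <= s <= L)%N -> (x < c s)%N ->
    (0 < head 0 (prefix_digits c s.-1 ++ x :: nseq l 0 ++ b))%N ->
    legal L c b ->
    legal L c (prefix_digits c s.-1 ++ x :: nseq l 0%N ++ b).

(** [\sum_(1 <= i <= n) a_i G_(n + 1 - i)]; the sequence is indexed from 0, so
    that [nth 0 a i] is [a_(i + 1)]. *)
Definition digits_value (G : nat -> nat) (a : seq nat) : nat :=
  (\sum_(0 <= i < size a) nth 0 a i * G (size a - i))%N.

(** The legal decomposition of [N], which exists and is unique for [0 < N]. *)
Definition legal_decomposition (L : nat) (c G : nat -> nat) (N : nat) : seq nat :=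
  xget [::] [set a | legal L c a /\ digits_value G a = N].

(** The number [k(N)] of nonzero digits. *)
Definition num_nonzero (L : nat) (c G : nat -> nat) (N : nat) : nat :=
  count (fun a : nat => (0 < a)%N) (legal_decomposition L c G N).

(** Expectation under the uniform distribution on [[G_(n+1), G_(n+2))]. *)
Definition EQ (R : realType) (G : nat -> nat) (n : nat) (f : nat -> R) : R :=
  (\sum_(G n.+1 <= N < G n.+2) f N) / (G n.+2 - G n.+1)%N%:R.

Definition max_coef (L : nat) (c : nat -> nat) : nat :=
  (\max_(1 <= i < L.+1) c i)%N.

(** The coordinates [j, j'] in [{1, ..., L}] are elements of ['I_L.+1], the
    value [0] being excluded by [1 <= j] and by the conditions on [j']. *)
Definition in_calL (L : nat) (c : nat -> nat)
    (z : 'I_(max_coef L c).+1 * 'I_L.+1 * 'I_L.+1) : bool :=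
  let: (x, j, j') := z in
  (1 <= j)%N && (((x < c j)%N && (j' == 1 :> nat)%N)
                 || [&& (j < L)%N, x == c j :> nat & j' == j.+1 :> nat]).

Definition calL (L : nat) (c : nat -> nat) : finType :=
  {z : 'I_(max_coef L c).+1 * 'I_L.+1 * 'I_L.+1 | in_calL z}.

Section States.
Context (L : nat) (c : nat -> nat).
Implicit Types z : calL L c.

Definition digit z : nat := (val z).1.1.
Definition source z : nat := (val z).1.2.
Definition target z : nat := (val z).2.

Definition in_calL0 z : bool := (source z == 1%N) && (0 < digit z)%N.

End States.

Section Chain.
Context (R : realType) (L : nat) (c : nat -> nat).
Local Notation S := (calL L c).
Implicit Types (z : S) (h nu phi m : S -> R) (lambda : R).

Definition PL z z' : R :=
  if target z == source z' then (((max_coef L c).+1 * L)%N%:R)^-1 else 0.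

Definition PL_mx : 'M[R[i]]_#|{: S}| :=
  \matrix_(i, k) (PL (enum_val i) (enum_val k))%:C%C.

Definition perron_eigenvalue lambda : Prop :=
  [/\ 0 < lambda, eigenvalue PL_mx lambda%:C%C
    & forall mu : R[i], eigenvalue PL_mx mu -> `|mu| <= lambda%:C%C].

Definition perron_data lambda nu phi : Prop :=
  [/\ perron_eigenvalue lambda,
      (forall z, 0 < nu z) /\ (forall z, 0 < phi z),
      forall z', \sum_z nu z * PL z z' = lambda * nu z',
      forall z, \sum_z' PL z z' * phi z' = lambda * phi z
    & \sum_z phi z = 1 /\ \sum_z nu z * phi z = 1].

Definition Qmx lambda phi z z' : R :=
  (lambda * phi z)^-1 * PL z z' * phi z'.

Definition expect m h : R := \sum_z m z * h z.

Definition piQ nu phi z : R := nu z * phi z.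

Definition piQ1 nu phi (x : nat) : R := \sum_(z | digit z == x) piQ nu phi z.

Definition phi_tilde phi z : R :=
  if in_calL0 z then phi z / \sum_(z' | in_calL0 z') phi z' else 0.

Definition norm1 nu : R := \sum_z nu z.

Definition IminusQ lambda phi h : S -> R :=
  fun z => h z - \sum_z' Qmx lambda phi z z' * h z'.

(** Writing [h] as [(h - E h) + E h] with [E h] constant, linearity and
    [Qsharp 1 = 0] leave the inverse of [I - Q] on the mean-zero functions,
    applied to [h - E h]. *)
Definition Qsharp lambda nu phi h : S -> R :=
  'pinv_(fun=> (fun=> 0)) [set f : S -> R | expect (piQ nu phi) f = 0]
    (IminusQ lambda phi) (fun z => h z - expect (piQ nu phi) h).

Definition g z : R := if (0 < digit z)%N then 1 else 0.

Definition g_tilde nu phi z : R := g z - expect (piQ nu phi) g.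

Definition C_Lek nu phi : R := 1 - piQ1 nu phi 0.

Definition d_Lek lambda nu phi : R :=
  expect (phi_tilde phi) (Qsharp lambda nu phi g)
  + expect (piQ nu phi)
      (fun z => g z * Qsharp lambda nu phi (fun z' => (phi z')^-1) z)
    / norm1 nu.

Definition sigma2 lambda nu phi : R :=
  expect (piQ nu phi)
    (fun z => g_tilde nu phi z *
       (2 * Qsharp lambda nu phi (g_tilde nu phi) z - g_tilde nu phi z)).

End Chain.

(* Main.v *)
From HB Require Import structures.
Require Import Defs.
From mathcomp Require Import all_boot all_order all_algebra.
From mathcomp Require Import all_classical all_reals all_analysis.
From mathcomp Require Import zify ring lra.
Import Order.TTheory GRing.Theory Num.Theory numFieldNormedType.Exports.
Local Open Scope classical_set_scope.
Local Open Scope ring_scope.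

(** Read a legal decomposition from its leading digit on, remembering the
    index j of the coefficient with which the next digit is to be compared. A
    digit below c_j returns to index 1, the digit c_j moves on to j + 1 if
    j < L, and a decomposition may stop at any index; so a legal decomposition
    with n + 1 digits is the same as a path of n + 1 states of the chain that
    starts in calL0, its nonzero first digit being the only boundary condition.
    Paths of length n from index 1, ordered lexicographically, have as values
    the consecutive integers below G_(n+1) ([word_ofP], [word_of_value]), which
    identifies the uniform distribution on [G_(n+1), G_(n+2)) with the uniform
    distribution on such paths ([EQ_path_sum]).

    Let phi be the Perron right eigenvector. Dividing a sum over the paths from
    z by (lambda / p) ^ n * phi z, with p the nonzero entry of PL, turns path
    counting into the action of the stochastic matrix Q. Write
    A_n (z), B_n (z) and D_n (z) for the normalized sums over paths of 1, of the
    centered digit count X = (number of nonzero digits) - C_Lek (n + 1), and of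
    X^2. With h the centered indicator g_tilde,
      A_(n+1) = Q A_n,                    A_0 = 1 / phi,
      B_(n+1) = h A_(n+1) + Q B_n,        B_0 = h / phi,
      D_(n+1) = h^2 A_(n+1) + 2 h Q B_n + Q D_n,
    and the expectations wanted are the ratios of the phi-averages over calL0 of
    B_n, respectively D_n, to that of A_n ([EQ_normalized]).

    The chain reaches the state of digit 0 and index 1 from everywhere in L + 1
    steps ([perron_chain]), so L + 1 steps of Q contract the oscillation of
    functions. Hence a recursion x_(n+1) = Q x_n + r_n whose forcing converges
    to r stays within o(1) of its stationary mean plus the solution of the
    Poisson equation (I - Q) F = r - E r, with E the stationary mean
    ([forced_cvg]); Qsharp solves that equation ([Qsharp_poisson]). With M the sum of nu, f = Qsharp g and
    w = Qsharp (1 / phi) this gives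
      A_n --> M,      B_n --> M f + E (h w),
    the constant being what remains of the telescoping sum of the E (h A_k), and
    then, by Cesaro averaging of E D_(n+1) - E D_n,
      D_n / (n + 1) --> M E (h (2 f - h)) = M sigma2.
    Dividing by the limit of A_n yields d_Lek and sigma2.

    The relative error in the second statement requires sigma2 <> 0. Since
    h = f - Q f, sigma2 is the stationary mean of the one-step conditional
    variances of f. Its term at the loop of the state of digit 0 and index 1
    is a positive multiple of h^2 there, and h takes the value - C_Lek < 0 at
    this state ([sigma2_gt0]). *)

Set Implicit Arguments.
Unset Strict Implicit.

(** * The digit automaton and its order-preserving numeration *)
Section Numeration.
Context (L : nat) (c G : nat -> nat).
Context (adm : admissible L c).
Context (recG : positive_linear_recursion L c G).
Local Open Scope nat_scope.

Lemma L_gt0 : 0 < L. Proof. by case: adm. Qed.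
Lemma c1_gt0 : 0 < c 1. Proof. by case: adm => _; rewrite muln_gt0 => /andP[]. Qed.
Lemma cL_gt0 : 0 < c L. Proof. by case: adm => _; rewrite muln_gt0 => /andP[]. Qed.

(** The automaton: [j] is the index of the coefficient that bounds the next
    digit. Every state is final, since a decomposition may stop inside a
    block. *)
Fixpoint accepts (j : nat) (s : seq nat) : bool :=
  if s is x :: s' then
    (x < c j) && accepts 1 s' || [&& j < L, x == c j & accepts j.+1 s']
  else true.

Fixpoint num_words (j n : nat) : nat :=
  if n is n'.+1 then
    c j * num_words 1 n' + (if j < L then num_words j.+1 n' else 0)
  else 1.

(** The greedy algorithm: the [N]-th word, in increasing order, among those
    of length [n] accepted from [j]. *)
Fixpoint word_of (j n N : nat) : seq nat :=
  if n is n'.+1 then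
    let x := N %/ G n'.+1 in
    if x < c j then x :: word_of 1 n' (N %% G n'.+1)
    else c j :: word_of j.+1 n' (N - c j * G n'.+1)
  else [::].

Lemma size_word_of j n N : size (word_of j n N) = n.
Proof. by elim: n j N => //= n IH j N; case: ifP => _ /=; rewrite IH. Qed.

(** Following the run of maximal digits for [k] steps, and counting at each
    step the words that leave it. *)
Lemma num_words_unroll j k n : j + k <= L ->
  num_words j (k + n) =
    \sum_(0 <= i < k) c (j + i) * num_words 1 (k + n - i.+1) + num_words (j + k) n.
Proof.
elim: k j n => [|k IH] j n jkL; first by rewrite big_geq // addn0 !add0n.
rewrite addSn /= ifT; last by lia.
rewrite (IH j.+1) ?addSn; last by lia.
rewrite big_nat_recl // addn0 subn1 /= addnA addnS; congr (_ + _ + _).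
by apply: eq_bigr => i _; rewrite addnS addSn subSS.
Qed.

(** Both sides satisfy the same recursion. Unrolling the run of maximal digits
    to its end gives the term [+ 1] of the short recursion when the run is cut
    by the end of the word ([n < L]), and no such term when it is cut by the
    last coefficient. *)
Lemma num_words_recurrence n : num_words 1 n = G n.+1.
Proof.
have [G1 Gle Ggt] := recG; have L0 := L_gt0.
elim/ltn_ind: n => n IH.
have [nL|Ln] := ltnP n L.
  case: (posnP n) => [-> //|n0].
  rewrite Gle; last by lia.
  have := @num_words_unroll 1 n 0; rewrite addn0 /= => -> //.
  congr (_ + _); rewrite big_add1 /= big_nat [RHS]big_nat.
  by apply: eq_bigr => i /andP[_ ilt]; rewrite add1n IH; [congr (_ * G _)|]; lia.
rewrite Ggt // -{1}(subnKC (leq_trans (leq_pred L) Ln)).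
rewrite num_words_unroll; last by lia.
have -> : n - L.-1 = (n - L).+1 by lia.
rewrite big_add1 /= -[in RHS](prednK L0) big_nat_recr //= add1n prednK // ltnn addn0.
congr (_ + _).
  rewrite big_nat [RHS]big_nat.
  by apply: eq_bigr => i /andP[_ ilt]; rewrite add1n IH; [congr (_ * G _)|]; lia.
by rewrite IH; [congr (_ * G _)|]; lia.
Qed.

Lemma G_gt0 n : 0 < G n.+1.
Proof.
rewrite -num_words_recurrence; elim: n => //= n IH.
by rewrite addn_gt0 muln_gt0 c1_gt0 IH.
Qed.

Lemma G_leS n : G n.+1 <= G n.+2.
Proof.
rewrite -!num_words_recurrence [leqRHS]/=.
by rewrite (leq_trans _ (leq_addr _ _)) // leq_pmull // c1_gt0.
Qed.

Lemma G_homo m n : m <= n -> G m.+1 <= G n.+1.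
Proof. by apply: (homo_leq (f := fun k => G k.+1) leqnn leq_trans) => k; apply: G_leS. Qed.

Lemma digits_value_cons x s :
  digits_value G (x :: s) = x * G (size s).+1 + digits_value G s.
Proof. by rewrite /digits_value /= big_nat_recl //= subn0. Qed.

(** A digit below [c j] leaves a remainder below one unit of its place value,
    so all the words with such a digit come before those with digit [c j]. *)
Lemma digits_value_lt j s : 0 < j <= L -> accepts j s ->
  digits_value G s < num_words j (size s).
Proof.
elim: s j => [|x s IH] j jL /=; first by rewrite /digits_value big_geq.
rewrite digits_value_cons num_words_recurrence => /orP[/andP[xc s1]|].
  have := IH 1 (L_gt0 : 0 < 1 <= L) s1; rewrite num_words_recurrence => slt.
  rewrite (@leq_trans (c j * G (size s).+1)) ?leq_addr //.
  by rewrite (@leq_trans (x.+1 * G (size s).+1)) ?leq_mul2r ?xc ?orbT // mulSn; lia.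
by case/and3P=> jltL /eqP -> sj; rewrite jltL ltn_add2l IH.
Qed.

(** With [word_ofP], the words of a given length are in bijection with an
    initial interval of the integers. This yields existence and uniqueness of
    legal decompositions at once. *)
Lemma word_of_value j s : 0 < j <= L -> accepts j s ->
  word_of j (size s) (digits_value G s) = s.
Proof.
elim: s j => [//|x s IH] j jL /=; rewrite digits_value_cons.
have G0 := G_gt0 (size s).
case/orP=> [/andP[xc s1]|/and3P[jltL /eqP -> sj]].
  have L1 : 0 < 1 <= L by rewrite L_gt0.
  have := digits_value_lt L1 s1; rewrite num_words_recurrence => slt.
  by rewrite divnMDl // divn_small // addn0 xc modnMDl modn_small // IH.
rewrite divnMDl // ifF; last by apply/negbTE; rewrite -leqNgt leq_addr.
by rewrite addKn IH.
Qed.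

Lemma word_ofP j n N : 0 < j <= L -> N < num_words j n ->
  accepts j (word_of j n N) /\ digits_value G (word_of j n N) = N.
Proof.
have L1 : 0 < 1 <= L by rewrite L_gt0.
elim: n j N => [|n IH] j N jL /=.
  by rewrite ltnS leqn0 => /eqP ->; split => //; rewrite /digits_value big_geq.
have G0 := G_gt0 n.
rewrite num_words_recurrence => Nlt; case: ifP => [xc|/negbT].
  have Nm : N %% G n.+1 < num_words 1 n by rewrite num_words_recurrence ltn_mod.
  have [a1 a2] := IH 1 _ L1 Nm.
  by rewrite digits_value_cons /= xc a1 a2 size_word_of -divn_eq.
rewrite -leqNgt leq_divRL // => cN.
have jltL : j < L by move: Nlt; case: ifP => // _; rewrite addn0; lia.
rewrite jltL in Nlt.
have Nm : N - c j * G n.+1 < num_words j.+1 n by lia.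
have [a1 a2] := IH j.+1 _ (jltL : 0 < j.+1 <= L) Nm.
rewrite digits_value_cons /= jltL eqxx a1 a2 size_word_of orbT; split => //; lia.
Qed.

Lemma accepts_prefix j k t : j + k <= L -> accepts (j + k) t ->
  accepts j (map c (iota j k) ++ t).
Proof.
elim: k j => [|k IH] j; first by rewrite addn0.
rewrite addnS -addSn => jk tk; rewrite [map _ _]/= cat_cons [accepts _ _]/=.
by rewrite eqxx IH // andbT; apply/orP; right; lia.
Qed.

Lemma accepts_zeros l t : accepts 1 t -> accepts 1 (nseq l 0 ++ t).
Proof. by move=> t1; elim: l => //= l ->; rewrite c1_gt0. Qed.

Lemma legal_accepts a : legal L c a -> accepts 1 a /\ 0 < head 0 a.
Proof.
elim=> {a} [n /andP[n0 nL] h0|s x l sL xs h0|s x l b sL xs h0 _ [b1 _]]; split => //.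
- by rewrite -[prefix_digits c n]cats0; apply: accepts_prefix.
- apply: accepts_prefix => /=; first lia.
  have -> : 1 + s.-1 = s by lia.
  by rewrite xs -[nseq l 0]cats0 accepts_zeros.
- apply: accepts_prefix => /=; first lia.
  have -> : 1 + s.-1 = s by lia.
  by rewrite xs accepts_zeros.
Qed.

(** Cutting a word at its first non-maximal digit, which is where the first
    block of a legal decomposition ends. *)
Lemma accepts_split j s : j <= L -> accepts j s ->
  (s = map c (iota j (size s)) /\ j + size s <= L) \/
  exists k x t, [/\ s = map c (iota j k) ++ x :: t, j + k <= L, x < c (j + k)
                  & accepts 1 t].
Proof.
elim: s j => [|x s IH] j jL /=; first by left; rewrite addn0.
case/orP=> [/andP[xc s1]|/and3P[jltL /eqP -> sj]].
  by right; exists 0, x, s; rewrite addn0.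
have [[se jsL]|[k [y [t [se jk yc t1]]]]] := IH _ jltL sj.
  by left; rewrite -se addnS.
by right; exists k.+1, y, t; rewrite addnS -addSn; split => //=; rewrite se.
Qed.

Lemma split_zeros (t : seq nat) :
  exists l b, t = nseq l 0 ++ b /\ (b = [::] \/ 0 < head 0 b).
Proof.
elim: t => [|[|x] t [l [b [-> hb]]]]; first by exists 0, [::]; split => //; left.
  by exists l.+1, b.
by exists 0, (x.+1 :: nseq l 0 ++ b); split => //; right.
Qed.

Lemma accepts_drop_zeros l b : accepts 1 (nseq l 0 ++ b) -> accepts 1 b.
Proof.
elim: l => //= l IH; rewrite c1_gt0 /= => /orP[/IH//|/and3P[_ /eqP c10]].
by have := c1_gt0; rewrite -c10.
Qed.

(** Induction on the length: after the first block, the zeros are absorbed in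
    [l], and what follows them is empty or has a positive leading digit. *)
Lemma accepts_legal a : accepts 1 a -> 0 < head 0 a -> legal L c a.
Proof.
have [n] := ubnP (size a); elim: n a => // n IH a an a1 h0.
have [[ae aL]|[k [x [t [ae kL xc t1]]]]] := accepts_split L_gt0 a1.
  have -> : a = prefix_digits c (size a) by [].
  apply: legal_prefix; last by rewrite /prefix_digits -ae.
  by case: a ae h0 aL {a1 an} => //=.
have [l [b [te hb]]] := split_zeros t.
have ke : k = (1 + k).-1 by [].
have k1 : 1 <= 1 + k <= L by [].
case: hb => [b0|hb].
  rewrite te b0 cats0 in ae; rewrite {}ae in h0 *.
  by rewrite [in iota 1 k]ke in h0 *; apply: legal_last.
rewrite te in ae t1.
have lb : legal L c b.
  apply: IH => //; last exact: accepts_drop_zeros t1.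
  by move: an; rewrite ae !size_cat /= size_cat; lia.
rewrite {}ae in h0 *.
by rewrite [in iota 1 k]ke in h0 *; apply: legal_cons.
Qed.

Lemma digits_value_ge a : 0 < head 0 a -> G (size a) <= digits_value G a.
Proof.
case: a => //= x a x0; rewrite digits_value_cons.
by rewrite (leq_trans _ (leq_addr _ _)) // leq_pmull.
Qed.

Lemma head_word_of n N : G n.+1 <= N -> 0 < head 0 (word_of 1 n.+1 N).
Proof.
by move=> GN /=; case: ifP => _ /=; rewrite ?c1_gt0 // divn_gt0 // G_gt0.
Qed.

(** A positive leading digit forces the value of a word of length [k] into
    [[G_k, G_(k+1))]; these intervals being disjoint, the length of a
    decomposition is determined by its value. *)
Lemma legal_decompositionE n N : G n.+1 <= N < G n.+2 ->
  legal_decomposition L c G N = word_of 1 n.+1 N.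
Proof.
move=> /andP[GN NG]; have L1 : 0 < 1 <= L by rewrite L_gt0.
have Nw : N < num_words 1 n.+1 by rewrite num_words_recurrence.
have [w1 wN] := word_ofP L1 Nw.
rewrite /legal_decomposition; case: xgetP => [a _ [la aN]|/(_ (word_of 1 n.+1 N))]; last first.
  by case; split => //; apply: accepts_legal => //; apply: head_word_of.
have [a1 h0] := legal_accepts la.
suff sa : size a = n.+1 by rewrite -(word_of_value L1 a1) sa aN.
have := digits_value_ge h0; have := digits_value_lt L1 a1.
rewrite aN num_words_recurrence => ub lb.
have sa0 : 0 < size a by case: (a) h0.
case: (ltngtP (size a) n.+1) => // sn.
  by have := leq_trans ub (G_homo (sn : size a <= n)); rewrite ltnNge GN.
have := @G_homo n.+1 (size a).-1; rewrite prednK // => /(_ ltac:(lia)) Ga.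
by move: NG; rewrite ltnNge (leq_trans Ga lb).
Qed.

End Numeration.

(** * The states of the chain as edges of the automaton *)
Section States.
Context (L : nat) (c : nat -> nat).
Context (adm : admissible L c).
Local Open Scope nat_scope.
Local Notation S := (calL L c).
Implicit Types z : S.

(** The form of the constraints that fits the automaton: digit and source are
    free up to a bound, and they determine the target. The boolean [source < L]
    counts as 1 exactly when the digit [c (source z)] is allowed. *)
Lemma stateP z : [/\ 0 < source z <= L, digit z < c (source z) + (source z < L)
  & target z = if digit z < c (source z) then 1 else (source z).+1].
Proof.
case: z => -[[x j] j'] zin; rewrite /digit /source /target /=.
move: zin; rewrite /in_calL /= => /andP[j0 /orP[/andP[xc /eqP ->]|/and3P[jL /eqP xc /eqP ->]]].
  by rewrite xc j0 -ltnS ltn_ord; split => //; rewrite ltn_addr.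
by rewrite xc ltnn jL j0 -ltnS ltn_ord; split => //; rewrite addn1.
Qed.

Lemma state_inj z z' : digit z = digit z' -> source z = source z' -> z = z'.
Proof.
move=> dz sz; have tz : target z = target z'.
  by have [_ _ ->] := stateP z; have [_ _ ->] := stateP z'; rewrite dz sz.
move: dz sz tz; case: z => -[[x j] t] zin; case: z' => -[[x' j'] t'] zin'.
rewrite /digit /source /target /= => dz sz tz; apply/val_inj => /=.
by congr (_, _, _); apply: val_inj.
Qed.

Lemma state_exists x j : 0 < j <= L -> x < c j + (j < L) ->
  exists z, digit z = x /\ source z = j.
Proof.
move=> /andP[j0 jL] xc.
have cmax : c j <= max_coef L c.
  rewrite /max_coef (big_nat_widenl _ 0) //.
  by rewrite (@leq_bigmax_seq _ _ (leq 1) c) // mem_index_iota ltnS.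
have xM : x < (max_coef L c).+1 by move: xc; case: (j < L); lia.
have jM : j < L.+1 by [].
have [xj|xj] := ltnP x (c j).
  have tM : 1 < L.+1 by lia.
  have zin : in_calL (Ordinal xM, Ordinal jM, Ordinal tM) by rewrite /in_calL /= j0 xj.
  by exists (exist (fun y => is_true (in_calL y)) _ zin).
have jltL : j < L by move: xc; case: (j < L); lia.
have tM : j.+1 < L.+1 by [].
have zin : in_calL (Ordinal xM, Ordinal jM, Ordinal tM).
  rewrite /in_calL /= j0 jltL /= eqxx andbT; apply/orP; right.
  by move: xc; rewrite jltL; lia.
by exists (exist (fun y => is_true (in_calL y)) _ zin).
Qed.

(** This state is a loop, of digit 0; it makes the chain aperiodic and the
    variance positive. *)
Lemma zero_state : exists z0, [/\ digit z0 = 0, source z0 = 1 & target z0 = 1].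
Proof.
have L0 := L_gt0 adm; have c1 := c1_gt0 adm.
have [z [dz sz]] := @state_exists 0 1 (L0 : 0 < 1 <= L) (ltn_addr _ c1).
by exists z; split => //; have [_ _ ->] := stateP z; rewrite dz sz c1.
Qed.

(** For [(L, c 1) = (1, 1)] the only state would be the loop of digit 0. *)
Lemma calL0_nonempty : exists z, in_calL0 z.
Proof.
have L0 := L_gt0 adm; have c1 := c1_gt0 adm.
have [z [dz sz]] : exists z, digit z = 1 /\ source z = 1.
  apply: state_exists; first exact: (L0 : 0 < 1 <= L).
  have [L1|L1] := ltnP 1 L; first by lia.
  have [_ _ Lc] := adm; have LE : L = 1 by lia.
  by rewrite addn0; case: (ltngtP (c 1) 1) => // c1E; [lia | rewrite LE c1E in Lc].
by exists z; rewrite /in_calL0 sz dz.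
Qed.

Lemma target_bound z : 0 < target z <= L.
Proof.
have [/andP[s0 sL] dz ->] := stateP z; have L0 := L_gt0 adm.
by case: ifP => // /negbT; move: dz; case: (source z < L) / boolP => //; lia.
Qed.

Lemma sum_states (R : realType) j (F : S -> R) (f : nat -> R) : 0 < j <= L ->
  (forall z, source z = j -> F z = f (digit z)) ->
  (\sum_(z | source z == j) F z =
   \sum_(0 <= x < c j) f x + (if (j < L)%N then f (c j) else 0))%R.
Proof.
move=> jL Ff.
have pick_state (x : 'I_(c j + (j < L))) : exists z, digit z = x /\ source z = j.
  exact: state_exists.
have [st stP] := choice pick_state.
have -> : (\sum_(0 <= x < c j) f x + (if (j < L)%N then f (c j) else 0) =
           \sum_(0 <= x < (c j + (j < L))%N) f x)%R.
  case: (j < L); last by rewrite addn0 addr0.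
  by rewrite addn1 big_nat_recr.
have n0 : 0 < c j + (j < L).
  have cL := cL_gt0 adm; have [jltL|Lj] := ltnP j L; first by rewrite addnC.
  have -> : j = L by lia.
  by rewrite addn0.
rewrite big_mkord (reindex_onto st (fun z => insubd (Ordinal n0) (digit z))) /=; last first.
  move=> z /eqP sz; have [_ dz _] := stateP z; rewrite sz in dz.
  by have [d s] := stP (insubd (Ordinal n0) (digit z)); apply: state_inj; rewrite ?s // d insubdK.
apply: eq_big => [x|x _]; have [d s] := stP x; last by rewrite Ff // d.
by rewrite s eqxx d; apply/eqP/val_inj; rewrite /= insubdK // unfold_in /=.
Qed.

End States.

(** * Sums over integers as sums over paths *)
Section PathSums.
Context (R : realType) (L : nat) (c G : nat -> nat).
Context (adm : admissible L c) (recG : positive_linear_recursion L c G).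
Local Notation S := (calL L c).
Implicit Types (z : S) (Phi Psi : seq nat -> R).

(** The sum of [Phi] over the digit sequences of the paths of [n.+1] states
    that start at [z]. *)
Fixpoint path_sum n z Phi : R :=
  if n is n'.+1 then
    \sum_(z' | source z' == target z) path_sum n' z' (fun s => Phi (digit z :: s))
  else Phi [:: digit z].

Definition word_sum j n Phi : R :=
  \sum_(0 <= N < num_words L c j n) Phi (word_of c G j n N).

Lemma path_sum_lin n z (a b : R) Phi Psi :
  path_sum n z (fun s => a * Phi s + b * Psi s) =
  a * path_sum n z Phi + b * path_sum n z Psi.
Proof.
elim: n z Phi Psi => //= n IH z Phi Psi.
by rewrite !mulr_sumr -big_split /=; apply: eq_bigr => z' _; rewrite IH.
Qed.

Lemma path_sum_ext n z Phi Psi :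
  (forall s, size s = n.+1 -> Phi s = Psi s) -> path_sum n z Phi = path_sum n z Psi.
Proof.
elim: n z Phi Psi => [|n IH] z Phi Psi PP /=; first exact: PP.
by apply: eq_bigr => z' _; apply: IH => s ss; apply: PP; rewrite /= ss.
Qed.

Lemma sum_nat_mul (k m : nat) (F : nat -> R) :
  \sum_(0 <= N < (k * m)%N) F N =
  \sum_(0 <= x < k) \sum_(0 <= r < m) F (x * m + r)%N.
Proof.
elim: k => [|k IH]; first by rewrite mul0n !big_geq.
rewrite big_nat_recr //= -IH mulSnr (@big_cat_nat _ _ _ (k * m)) ?leq_addr //=; congr (_ + _).
rewrite -{1}[(k * m)%N]add0n big_addn addKn.
by apply: eq_bigr => i _; rewrite addnC.
Qed.

Lemma word_sum0 j Phi : word_sum j 0 Phi = Phi [::].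
Proof. by rewrite /word_sum /= big_nat1. Qed.

Lemma word_sumS j n Phi : (0 < j <= L)%N ->
  word_sum j n.+1 Phi =
  \sum_(0 <= x < c j) word_sum 1 n (fun s => Phi (x :: s)) +
  (if (j < L)%N then word_sum j.+1 n (fun s => Phi (c j :: s)) else 0).
Proof.
move=> jL; have numE := num_words_recurrence adm recG; have G0 := G_gt0 adm recG n.
rewrite {1}/word_sum [num_words _ _ _ _]/= numE.
rewrite (@big_cat_nat _ _ _ (c j * G n.+1)) ?leq_addr //=; congr (_ + _).
  rewrite sum_nat_mul; apply: eq_big_nat => x /andP[_ xc].
  rewrite /word_sum numE; apply: eq_big_nat => r /andP[_ rG].
  by rewrite divnMDl // divn_small // addn0 xc modnMDl modn_small.
rewrite -{1}[(c j * G n.+1)%N]add0n big_addn addKn.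
case: ifP => _; last by rewrite big_geq.
apply: eq_bigr => r _; rewrite addnC divnMDl // ifF ?addKn //.
by apply/negbTE; rewrite -leqNgt leq_addr.
Qed.

Lemma path_sum_word n z Phi :
  path_sum n z Phi = word_sum (target z) n (fun s => Phi (digit z :: s)).
Proof.
elim: n z Phi => [|n IH] z Phi; first by rewrite word_sum0.
rewrite word_sumS ?target_bound //=.
have tL := target_bound adm z.
pose h x := word_sum (if (x < c (target z))%N then 1%N else (target z).+1) n
              (fun s => Phi (digit z :: x :: s)).
rewrite (@sum_states L c adm R (target z) _ h tL); last first.
  by move=> z' sz; rewrite IH; have [_ _ ->] := stateP z'; rewrite sz.
congr (_ + _); last by rewrite /h ltnn.
by apply: eq_big_nat => x /andP[_ xc]; rewrite /h xc.
Qed.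

(** Among the words of length [n.+1], those of value below [G n.+1] are those
    with leading digit 0, that is, the paths that start at [zero_state]. *)
Lemma sum_block n Phi :
  \sum_(G n.+1 <= N < G n.+2) Phi (word_of c G 1 n.+1 N) =
  \sum_(z : S | in_calL0 z) path_sum n z Phi.
Proof.
have L1 : (0 < 1 <= L)%N by rewrite (L_gt0 adm).
have c1 := c1_gt0 adm.
have all_words : word_sum 1 n.+1 Phi = \sum_(z : S | source z == 1%N) path_sum n z Phi.
  rewrite word_sumS //.
  pose h x := word_sum (if (x < c 1)%N then 1%N else 2%N) n (fun s => Phi (x :: s)).
  rewrite (@sum_states L c adm R 1 _ h L1); last first.
    by move=> z sz; rewrite path_sum_word; have [_ _ ->] := stateP z; rewrite sz.
  congr (_ + _); last by rewrite /h ltnn.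
  by apply: eq_big_nat => x /andP[_ xc]; rewrite /h xc.
have [z0 [d0 s0 t0]] := zero_state adm.
have numE := num_words_recurrence adm recG.
move: all_words; rewrite /word_sum numE (@big_cat_nat _ _ _ (G n.+1)) ?(G_leS adm recG) //=.
rewrite (bigID (fun z : S => (0 < digit z)%N)) /= [RHS]addrC.
have -> : \sum_(z : S | (source z == 1%N) && ~~ (0 < digit z)%N) path_sum n z Phi =
          path_sum n z0 Phi.
  rewrite (big_pred1 z0) // => z; rewrite -eqn0Ngt.
  apply/andP/eqP => [[/eqP sz /eqP dz]|->]; last by rewrite s0 d0.
  by apply: state_inj; rewrite ?sz ?dz.
have -> : \sum_(0 <= N < G n.+1)
     Phi (if (N %/ G n.+1 < c 1)%N then (N %/ G n.+1)%N :: word_of c G 1 n (N %% G n.+1)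
          else c 1%N :: word_of c G 2 n (N - c 1%N * G n.+1)) = path_sum n z0 Phi.
  rewrite path_sum_word t0 d0 /word_sum numE.
  by apply: eq_big_nat => N /andP[_ NG]; rewrite divn_small // c1 modn_small.
by move=> /addrI ->.
Qed.

Lemma num_words_gt0 j n : (0 < j <= L)%N -> (0 < num_words L c j n)%N.
Proof.
elim: n j => //= n IH j jL; rewrite addn_gt0; apply/orP.
have [jltL|Lj] := ltnP j L; [right; apply: IH; lia | left].
have -> : j = L by lia.
by rewrite muln_gt0 cL_gt0 //= IH // (L_gt0 adm).
Qed.

Lemma block_nonempty n : (G n.+1 < G n.+2)%N.
Proof.
have numE := num_words_recurrence adm recG.
rewrite -2!numE [X in (_ < X)%N]/= numE.
have G0 := G_gt0 adm recG n; have c1 := c1_gt0 adm; have L0 := L_gt0 adm.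
have [L1|L1] := ltnP 1 L.
  have := @num_words_gt0 2 n L1; have := leq_pmull (G n.+1) c1; lia.
have LE : L = 1%N by lia.
have c2 : (2 <= c 1)%N.
  by have [_ _ Lc] := adm; case: (ltngtP (c 1) 1%N) => // c1E; [lia | rewrite LE c1E in Lc].
by rewrite addn0; nia.
Qed.

Lemma EQ_path_sum n (f : nat -> R) Phi :
  (forall N, (G n.+1 <= N < G n.+2)%N -> f N = Phi (legal_decomposition L c G N)) ->
  EQ G n f = (\sum_(z : S | in_calL0 z) path_sum n z Phi) /
             (\sum_(z : S | in_calL0 z) path_sum n z (fun=> 1)).
Proof.
move=> fP; rewrite /EQ -!sum_block; congr (_ / _).
  apply: eq_big_nat => N NG.
  by rewrite fP // (legal_decompositionE adm recG NG).
by rewrite sumr_const_nat.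
Qed.

End PathSums.

(** * Limits of real sequences *)
Section SequenceLimits.
Context (R : realType).
Implicit Types u v t : nat -> R.

(** Once [t] is below [(1 - rho) * (e / 2)], the excess of [v] over [e / 2] is
    multiplied by at most [rho] every [m] steps. *)
Lemma contraction_cvg0 v t (m : nat) (rho : R) :
  (0 < m)%N -> 0 <= rho < 1 -> (forall n, 0 <= v n) ->
  (forall n, v (n + m)%N <= rho * v n + t n) ->
  t @ \oo --> (0 : R) -> v @ \oo --> (0 : R).
Proof.
move=> m0 /andP[r0 r1] v0 vt t0; apply/cvgrPdist_le => e e0.
have e2 : 0 < (1 - rho) * (e / 2) by rewrite mulr_gt0 ?divr_gt0 ?subr_gt0.
have [N _ tN] := cvgr0_norm_lt _ t0 _ e2.
have iterate k n : (N <= n)%N -> v (n + k * m)%N <= e / 2 + rho ^+ k * v n.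
  move=> Nn; elim: k => [|k IH]; first by rewrite addn0 expr0 mul1r lerDr divr_ge0 ?ltW.
  rewrite mulSn addnC -addnA addnC [(k * m + n)%N]addnC.
  have := vt (n + k * m)%N; have := tN (n + k * m)%N (leq_trans Nn (leq_addr _ _)).
  move=> /ltW/(le_trans (ler_norm _)) tk vk.
  apply: (le_trans vk); have := ler_wpM2l r0 IH.
  by rewrite exprS -mulrA; set w := rho ^+ k * v n; move: tk; lra.
set M := \sum_(i < m) v (N + i)%N.
have vM n : (N <= n)%N -> v n <= e / 2 + rho ^+ ((n - N) %/ m) * M.
  move=> Nn; have -> : v n = v (N + (n - N) %% m + (n - N) %/ m * m)%N.
    by congr v; rewrite -addnA [X in (_ + X)%N]addnC -divn_eq subnKC.
  apply: (le_trans (iterate _ _ (leq_addr _ _))).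
  rewrite lerD2l ler_wpM2l ?exprn_ge0 //.
  rewrite /M (bigD1 (Ordinal (ltn_pmod (n - N) m0))) //= lerDl.
  exact: sumr_ge0.
have rho_lt1 : `|rho| < 1 by rewrite ger0_norm.
have e20 : 0 < e / 2 by rewrite divr_gt0.
have [K _ rK] := cvgr0_norm_lt _ (cvg_geometric M rho_lt1) _ e20.
exists (N + K * m)%N => // n /= Nn.
have Nn' : (N <= n)%N by apply: leq_trans Nn; apply: leq_addr.
rewrite sub0r normrN ger0_norm //; apply: (le_trans (vM n Nn')).
have Kn : (K <= (n - N) %/ m)%N by rewrite leq_divRL // leq_subRL.
have := rK _ Kn; rewrite /geometric /= mulrC => /ltW/(le_trans (ler_norm _)).
lra.
Qed.

Lemma cvg_sum_fin (I : finType) (x : nat -> I -> R) (l : I -> R) :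
  (forall i, (fun n => x n i) @ \oo --> l i) ->
  (fun n => \sum_i x n i) @ \oo --> \sum_i l i.
Proof.
move=> xl; elim: (index_enum I) => [|i s IH].
  by rewrite big_nil; under eq_fun do rewrite big_nil; apply: cvg_cst.
by rewrite big_cons; under eq_fun do rewrite big_cons; apply: cvgD.
Qed.

Lemma cvg_subK u v (a b : R) : (fun n => u n - v n) @ \oo --> a ->
  v @ \oo --> b -> u @ \oo --> a + b.
Proof.
move=> uv vb; rewrite (_ : u = fun n => (u n - v n) + v n); first exact: cvgD.
by apply/funext => n; rewrite subrK.
Qed.

Lemma cesaro_increments (s r : nat -> R) (l : R) :
  (forall n, s n.+1 = s n + r n) -> r @ \oo --> l ->
  (fun n => s n / n.+1%:R) @ \oo --> l.
Proof.
move=> sr rl; pose r' n := if n is k.+1 then r k else s 0%N.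
have -> : (fun n => s n / n.+1%:R) = arithmetic_mean r'.
  apply/funext => n; rewrite /arithmetic_mean /= mulrC; congr (_ * _).
  elim: n => [|n IH]; first by rewrite /series /= big_nat1.
  by rewrite sr IH [RHS]/series /= big_nat_recr.
by apply: cesaro; rewrite -cvg_shiftS.
Qed.

End SequenceLimits.

(** * Finite Markov chains: contraction and the Poisson equation *)
Section MarkovOperators.
Context (R : realType) (S : finType) (Q : S -> S -> R) (pi : S -> R).
Implicit Types (h : S -> R).

Definition step h : S -> R := fun z => \sum_z' Q z z' * h z'.
Definition mean h : R := \sum_z pi z * h z.
Definition osc h : R := \big[Num.max/0]_(p : S * S) (h p.1 - h p.2).

(** Doeblin's condition in operator form: from every state the chain is at
    [z0] after [m] steps with probability at least [delta]. It replaces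
    irreducibility and aperiodicity. *)
Record minorized_chain (z0 : S) (m : nat) (delta : R) : Prop := MinorizedChain {
  Q_ge0 : forall z z', 0 <= Q z z';
  Q_sum1 : forall z, \sum_z' Q z z' = 1;
  pi_ge0 : forall z, 0 <= pi z;
  pi_sum1 : \sum_z pi z = 1;
  pi_stat : forall z', \sum_z pi z * Q z z' = pi z';
  m_gt0 : (0 < m)%N;
  delta_gt0 : 0 < delta;
  minorization : forall h, (forall z, 0 <= h z) ->
    forall z, delta * h z0 <= iter m step h z }.

End MarkovOperators.

Section FiniteMarkovChain.
Context (R : realType) (S : finType) (Q : S -> S -> R) (pi : S -> R).
Context (z0 : S) (m : nat) (delta : R) (chain : minorized_chain Q pi z0 m delta).
Implicit Types (h f : S -> R) (x r : nat -> S -> R).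

Local Notation step := (step Q).
Local Notation mean := (mean pi).
Let Qge0 := Q_ge0 chain.
Let Qsum1 := Q_sum1 chain.
Let pige0 := pi_ge0 chain.
Let pisum1 := pi_sum1 chain.
Let minor := minorization chain.

Lemma osc_ge h z z' : h z - h z' <= osc h.
Proof. exact: (le_bigmax 0 (fun p : S * S => h p.1 - h p.2) (z, z')). Qed.

Lemma osc_ge0 h : 0 <= osc h.
Proof. exact: bigmax_ge_id. Qed.

Lemma osc_le h (a : R) : 0 <= a -> (forall z z', h z - h z' <= a) -> osc h <= a.
Proof. by move=> a0 ha; apply: bigmax_le => // -[z z'] _; apply: ha. Qed.

Lemma osc_add h f : osc (fun z => h z + f z) <= osc h + osc f.
Proof.
apply: osc_le => [|z z']; first by rewrite addr_ge0 ?osc_ge0.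
by have := osc_ge h z z'; have := osc_ge f z z'; lra.
Qed.

Lemma osc_le_sum h (a : R) : osc h <= 2 * \sum_z `|h z - a|.
Proof.
have term z : `|h z - a| <= \sum_z `|h z - a|.
  by rewrite (bigD1 z) //= lerDl sumr_ge0.
apply: osc_le => [|z z']; first by rewrite mulr_ge0 ?sumr_ge0.
have := term z; have := term z'; have := ler_norm (h z - a).
by have := ler_norm (a - h z'); rewrite distrC; lra.
Qed.

Lemma step_lin (b : R) h f z :
  step (fun w => h w + b * f w) z = step h z + b * step f z.
Proof. by rewrite /step mulr_sumr -big_split /=; apply: eq_bigr => w _; ring. Qed.

Lemma step_cst (a : R) z : step (fun=> a) z = a.
Proof. by rewrite /step -mulr_suml Qsum1 mul1r. Qed.

Lemma stepZ (b : R) f z : step (fun w => b * f w) z = b * step f z.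
Proof. by rewrite /step mulr_sumr; apply: eq_bigr => w _; ring. Qed.

Lemma iter_step_affine (a b : R) h k z :
  iter k step (fun w => a + b * h w) z = a + b * iter k step h z.
Proof.
elim: k z => //= k IH z.
rewrite -[X in X + _](step_cst a z) -step_lin.
by apply: eq_bigr => w _; rewrite IH.
Qed.

Lemma step_ge0 h : (forall z, 0 <= h z) -> forall z, 0 <= step h z.
Proof. by move=> h0 z; apply: sumr_ge0 => w _; rewrite mulr_ge0. Qed.

(** Apply the minorization to the nonnegative functions [h - min h] and
    [max h - h]: every value of the [k]-th iterate is at least
    [min h + d * (h z0 - min h)] and at most [max h - d * (max h - h z0)], and
    these bounds differ by [(1 - d) * osc h]. *)
Lemma osc_iter_step k (d : R) h :
  (forall f, (forall z, 0 <= f z) -> forall z, d * f z0 <= iter k step f z) ->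
  osc (iter k step h) <= (1 - d) * osc h.
Proof.
move=> dk.
have [zmin hmin] : exists z, forall w, h z <= h w.
  by case: (Order.TotalTheory.arg_minP h (erefl : predT z0)) => z _ hz; exists z => w; apply: hz.
have [zmax hmax] : exists z, forall w, h w <= h z.
  by case: (Order.TotalTheory.arg_maxP h (erefl : predT z0)) => z _ hz; exists z => w; apply: hz.
have d1 : d <= 1.
  have := dk (fun=> 1 + 0 * h z0) _ z0.
  rewrite (iter_step_affine 1 0 (fun=> h z0)) !mul0r addr0 mulr1; apply => _; exact: ler01.
apply: osc_le => [|z z']; first by rewrite mulr_ge0 ?osc_ge0 // subr_ge0.
have := dk (fun w => - h zmin + 1 * h w) _ z'.
rewrite iter_step_affine => /(_ (fun w => _)) lo.
have := dk (fun w => h zmax + - 1 * h w) _ z.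
rewrite iter_step_affine => /(_ (fun w => _)) hi.
have {}lo := lo ltac:(move=> w; rewrite mul1r addrC subr_ge0; exact: hmin).
have {}hi := hi ltac:(move=> w; rewrite mulN1r subr_ge0; exact: hmax).
have := ler_wpM2l (_ : 0 <= 1 - d) (osc_ge h zmax zmin).
rewrite subr_ge0 => /(_ d1); move: lo hi; lra.
Qed.

Lemma osc_step h : osc (step h) <= osc h.
Proof.
rewrite -[leRHS]mul1r -[X in X * _]subr0.
by apply: (@osc_iter_step 1 0) => f f0 z; rewrite mul0r; apply: step_ge0.
Qed.

Lemma mean_step h : mean (step h) = mean h.
Proof.
rewrite /mean /step; under eq_bigr do rewrite mulr_sumr.
rewrite exchange_big /=; apply: eq_bigr => z' _.
by rewrite -(pi_stat chain) mulr_suml; apply: eq_bigr => z _; rewrite mulrA.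
Qed.

Lemma mean_lin (b : R) h f : mean (fun w => h w + b * f w) = mean h + b * mean f.
Proof. by rewrite /mean mulr_sumr -big_split /=; apply: eq_bigr => w _; ring. Qed.

Lemma mean_cst (a : R) : mean (fun=> a) = a.
Proof. by rewrite /mean -mulr_suml pisum1 mul1r. Qed.

Lemma meanZ (b : R) f : mean (fun w => b * f w) = b * mean f.
Proof. by rewrite /mean mulr_sumr; apply: eq_bigr => w _; ring. Qed.

Lemma dist_mean_le h z : `|h z - mean h| <= osc h.
Proof.
have mB a b : mean (fun w => a + b * h w) <= osc h -> a + b * mean h <= osc h.
  by rewrite mean_lin mean_cst.
have mle f : (forall w, f w <= osc h) -> mean f <= osc h.
  move=> fo; rewrite -[leRHS]mul1r -pisum1 mulr_suml; apply: ler_sum => w _.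
  by rewrite ler_wpM2l.
rewrite ler_norml lerNl; apply/andP; split.
- rewrite -[leLHS]/(- _) opprB addrC -[mean h]mul1r; apply/mB/mle => w.
  by rewrite addrC mul1r; apply: osc_ge.
- by rewrite -mulN1r; apply/mB/mle => w; rewrite mulN1r; apply: osc_ge.
Qed.

Lemma delta_le1 : delta <= 1.
Proof.
have := @minor (fun=> 1 + 0 * 1) _ z0.
rewrite (iter_step_affine 1 0 (fun=> 1)) !mul0r addr0 mulr1; apply => _; exact: ler01.
Qed.

(** Over [m] steps the oscillation contracts by [1 - delta], up to the
    oscillations of the [m] intermediate forcing terms. *)
Lemma osc_forced_cvg0 x r :
  (forall n z, x n.+1 z = step (x n) z + r n z) ->
  (fun n => osc (r n)) @ \oo --> (0 : R) -> (fun n => osc (x n)) @ \oo --> (0 : R).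
Proof.
move=> xr r0.
have gap n k : osc (fun z => x (n + k)%N z - iter k step (x n) z)
               <= \sum_(i < k) osc (r (n + i)%N).
  elim: k => [|k IH].
    by rewrite big_ord0 addn0; apply: osc_le => // z z'; rewrite !subrr.
  rewrite big_ord_recr /=.
  have -> : (fun z => x (n + k.+1)%N z - step (iter k step (x n)) z) =
            (fun z => step (fun w => x (n + k)%N w - iter k step (x n) w) z + r (n + k)%N z).
    apply/funext => z; rewrite addnS xr -[X in X + _ - _]/(step (x (n + k)%N) z).
    rewrite /step addrAC -sumrB; congr (_ + _).
    by apply: eq_bigr => w _; rewrite mulrBr.
  apply: (le_trans (osc_add _ _)); rewrite lerD2r.
  exact: (le_trans (osc_step _) IH).
apply: (@contraction_cvg0 R _ (fun n => \sum_(i < m) osc (r (n + i)%N)) m (1 - delta)) => //.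
- exact: m_gt0 chain.
- by rewrite subr_ge0 delta_le1 ltrBlDr ltrDl (delta_gt0 chain).
- by move=> n; apply: osc_ge0.
- move=> n.
  have -> : x (n + m)%N = (fun z => iter m step (x n) z + (x (n + m)%N z - iter m step (x n) z)).
    by apply/funext => z; rewrite addrC subrK.
  by apply: (le_trans (osc_add _ _)); rewrite lerD ?osc_iter_step.
- suff : (fun n => \sum_(i < m) osc (r (n + i)%N)) @ \oo --> \sum_(i < m) (0 : R).
    by rewrite big1.
  apply: cvg_sum_fin => i.
  by apply: (cvg_comp (fun n => (n + i)%N) (fun n => osc (r n))) r0; apply: cvg_addnr.
Qed.

Lemma harmonic_cst h : (forall z, step h z = h z) -> forall z, h z = mean h.
Proof.
move=> hh z; have fix_k k : iter k step h = h.
  by elim: k => //= k ->; apply/funext.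
have := osc_iter_step h minor; rewrite fix_k => oh.
have o0 : osc h = 0.
  apply/eqP; rewrite eq_le osc_ge0 andbT.
  have : 0 <= - (delta * osc h) by lra.
  by rewrite oppr_ge0 pmulr_rle0 ?(delta_gt0 chain).
apply/eqP; rewrite -subr_eq0 -normr_le0 -o0; exact: dist_mean_le.
Qed.

Lemma poisson_unique f f' : mean f = mean f' ->
  (forall z, f z - step f z = f' z - step f' z) -> f = f'.
Proof.
move=> ff' pf; apply/funext => z.
have := @harmonic_cst (fun w => f w + -1 * f' w) _ z.
rewrite mean_lin ff' !mulN1r subrr => H; apply/eqP; rewrite -subr_eq0; apply/eqP/H => w.
by rewrite step_lin; have := pf w; lra.
Qed.

(** The map [f |-> f - Q f + E f] preserves the mean, so that its kernel is
    trivial by [poisson_unique]; in finite dimension it is then onto, and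
    a preimage of a function of mean 0 has mean 0. *)
Lemma poisson_exists h : mean h = 0 ->
  exists2 f, mean f = 0 & forall z, f z - step f z = h z.
Proof.
move=> mh.
pose T (f : {ffun S -> R^o}) : {ffun S -> R^o} := [ffun z => f z - step f z + mean f].
have T_linear : linear T.
  move=> a f f'; apply/ffunP => z; rewrite !ffunE.
  have -> : step (a *: f + f') z = step f' z + a * step f z.
    by rewrite -step_lin; apply: eq_bigr => w _; rewrite !ffunE addrC.
  have -> : mean (a *: f + f') = mean f' + a * mean f.
    by rewrite -mean_lin; apply: eq_bigr => w _; rewrite !ffunE addrC.
  rewrite /GRing.scale /=; ring.
have mT (f : {ffun S -> R^o}) : mean (T f) = mean f.
  have -> : mean (T f) = mean (fun z => f z + 1 * mean f + -1 * step f z).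
    by apply: eq_bigr => z _; rewrite ffunE; congr (_ * _); ring.
  by rewrite !mean_lin mean_cst mean_step; ring.
pose T_lin := GRing.isLinear.Build R _ _ _ T T_linear.
pose Tl : {linear {ffun S -> R^o} -> {ffun S -> R^o}} := HB.pack T T_lin.
have ker0 : lker (linfun Tl) == 0%VS.
  apply/lker0P => f1 f2; rewrite !lfunE /= => Tf.
  have mf : mean f1 = mean f2 by rewrite -mT Tf mT.
  have f12 : f1 = f2 :> (S -> R).
    apply: poisson_unique => // z.
    by move/ffunP: Tf => /(_ z); rewrite !ffunE mf => /addIr.
  by apply/ffunP => z; rewrite f12.
have : [ffun z => h z : R^o] \in limg (linfun Tl) by rewrite (lker0_limgf ker0) memvf.
case/memv_imgP => f _; rewrite lfunE /= => /ffunP Tf.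
have mf : mean f = 0.
  by rewrite -mT -[RHS]mh; apply: eq_bigr => z _; rewrite -Tf ffunE.
by exists f => // z; have := Tf z; rewrite !ffunE mf addr0.
Qed.

(** Subtracting the solution [f] of the Poisson equation leaves a recursion with
    forcing [r n - l], up to a constant, whose oscillation tends to 0. *)
Lemma forced_cvg x r (l f : S -> R) :
  (forall n z, x n.+1 z = step (x n) z + r n z) ->
  (forall z, (fun n => r n z) @ \oo --> l z) ->
  mean f = 0 -> (forall z, f z - step f z = l z - mean l) ->
  forall z, (fun n => x n z - mean (x n)) @ \oo --> f z.
Proof.
move=> xr rl mf pf z.
pose y n w := x n w + -1 * f w.
pose s n w := r n w - l w + mean l.
have ys n w : y n.+1 w = step (y n) w + s n w.
  by rewrite /y /s xr step_lin; have := pf w; lra.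
have s0 : (fun n => osc (s n)) @ \oo --> (0 : R).
  have ub : (fun n => 2 * \sum_w `|s n w - mean l|) @ \oo --> (0 : R).
    suff Sto0 : (fun n => \sum_w `|s n w - mean l|) @ \oo --> (0 : R).
      suff : (fun n => 2 * \sum_w `|s n w - mean l|) @ \oo --> 2 * (0 : R) by rewrite mulr0.
      by apply: cvgM => //; apply: cvg_cst.
    suff : (fun n => \sum_w `|s n w - mean l|) @ \oo --> \sum_(w : S) (0 : R) by rewrite big1.
    apply: cvg_sum_fin => w; apply/norm_cvg0P; rewrite /s.
    under eq_fun do rewrite addrK.
    by rewrite -(subrr (l w)); apply: cvgB => //; apply: cvg_cst.
  apply: (squeeze_cvgr _ (cvg_cst 0) ub).
  by near=> n; rewrite osc_ge0 osc_le_sum.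
have y0 := osc_forced_cvg0 ys s0.
have d0 : (fun n => y n z - mean (y n)) @ \oo --> (0 : R).
  apply/norm_cvg0P; apply: (squeeze_cvgr _ (cvg_cst 0) y0).
  by near=> n; rewrite normr_ge0 dist_mean_le.
have -> : (fun n => x n z - mean (x n)) = (fun n => f z + (y n z - mean (y n))).
  by apply/funext => n; rewrite /y mean_lin mf; ring.
by rewrite -[X in _ --> X]addr0; apply: cvgD => //; apply: cvg_cst.
Unshelve. all: by end_near.
Qed.

Lemma cvg_mean x (l : S -> R) :
  (forall z, (fun n => x n z) @ \oo --> l z) ->
  (fun n => mean (x n)) @ \oo --> mean l.
Proof.
move=> xl; apply: cvg_sum_fin => z.
by apply: cvgM => //; apply: cvg_cst.
Qed.

Lemma iter_step_cvg h z : (fun n => iter n step h z) @ \oo --> mean h.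
Proof.
have mI n : mean (iter n step h) = mean h by elim: n => //= n <-; rewrite mean_step.
have H : (fun n => iter n step h z - mean (iter n step h)) @ \oo --> (0 : R).
  apply: (@forced_cvg (fun n => iter n step h) (fun _ _ => 0) (fun=> 0) (fun=> 0)).
  - by move=> n v; rewrite addr0.
  - by move=> v; apply: cvg_cst.
  - exact: mean_cst.
  - by move=> v; rewrite step_cst mean_cst.
rewrite -[mean h]add0r; apply: (cvg_subK H).
by under eq_fun do rewrite mI; apply: cvg_cst.
Qed.

(** The recursions below are those of the expectations of [u Z_n] weighted by
    the powers 0, 1 and 2 of [gc Z_0 + ... + gc Z_n], for the chain [Z] started
    at [z]. *)
Section AdditiveFunctional.
Context (u gc f w : S -> R) (A B D : nat -> S -> R).
Context (A0 : A 0%N = u) (AS : forall n z, A n.+1 z = step (A n) z).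
Context (B0 : forall z, B 0%N z = gc z * u z)
  (BS : forall n z, B n.+1 z = gc z * A n.+1 z + step (B n) z).
Context (DS : forall n z, D n.+1 z =
  gc z ^+ 2 * A n.+1 z + 2 * gc z * step (B n) z + step (D n) z).
Context (gc_mean : mean gc = 0).
Context (f_mean : mean f = 0) (f_poisson : forall z, f z - step f z = gc z).
Context (w_mean : mean w = 0) (w_poisson : forall z, w z - step w z = u z - mean u).

Lemma weight_iter n : A n = iter n step u.
Proof. by elim: n => //= n <-; apply/funext => z. Qed.

Lemma weight_cvg z : (fun n => A n z) @ \oo --> mean u.
Proof. by under eq_fun do rewrite weight_iter; apply: iter_step_cvg. Qed.

(** Since [u = w - Q w + E u]. *)
Lemma weight_telescope n z : A n z = iter n step w z - iter n.+1 step w z + mean u.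
Proof.
elim: n z => [|n IH] z; first by rewrite A0 /= w_poisson subrK.
have -> : A n.+1 z = step (fun v => mean u + 1 * iter n step w v + -1 * iter n.+1 step w v) z.
  by rewrite AS; apply: eq_bigr => v _; rewrite IH; congr (_ * _); ring.
by rewrite !step_lin step_cst !iterS; ring.
Qed.

(** [mean (B n)] is the sum of the [mean (gc * A k)] for [k <= n], and the sum
    of the [A k] telescopes, up to multiples of [mean u] that [gc], of mean 0,
    does not see. *)
Lemma mean_moment1 n : mean (B n) = mean (fun z => gc z * (w z - iter n.+1 step w z)).
Proof.
have telescope k z : gc z * A k z =
    gc z * (w z - iter k.+1 step w z) + (-1) * (gc z * (w z - iter k step w z)) + mean u * gc z.
  by rewrite weight_telescope; ring.
elim: n => [|n IH].
  have -> : B 0%N = (fun z => gc z * A 0%N z) by apply/funext => z; rewrite A0 B0.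
  under [LHS]eq_bigr do rewrite telescope.
  rewrite -/(mean (fun z => _)) !mean_lin gc_mean.
  rewrite [X in _ + -1 * X](_ : _ = 0); first by ring.
  by rewrite /mean big1 // => z _; rewrite /= subrr !mulr0.
have -> : mean (B n.+1) = mean (fun z => gc z * A n.+1 z + 1 * step (B n) z).
  by apply: eq_bigr => z _; rewrite BS mul1r.
rewrite mean_lin mean_step IH.
under [X in X + _]eq_bigr do rewrite telescope.
by rewrite -/(mean (fun z => _)) !mean_lin gc_mean; ring.
Qed.

Lemma moment1_cvg z :
  (fun n => B n z) @ \oo --> mean u * f z + mean (fun v => gc v * w v).
Proof.
have Bc : (fun n => B n z - mean (B n)) @ \oo --> mean u * f z.
  apply: (@forced_cvg B (fun n v => gc v * A n.+1 v) (fun v => mean u * gc v)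
            (fun v => mean u * f v)).
  - by move=> n v; rewrite BS addrC.
  - move=> v; rewrite [mean u * _]mulrC; apply: cvgM; first exact: cvg_cst.
    by rewrite (cvg_shiftS (fun n => A n v)); apply: weight_cvg.
  - by rewrite meanZ f_mean mulr0.
  - by move=> v; rewrite meanZ gc_mean stepZ -f_poisson; ring.
have Bm : (fun n => mean (B n)) @ \oo --> mean (fun v => gc v * w v).
  under eq_fun do rewrite mean_moment1.
  apply: cvg_mean => v; apply: cvgM; first exact: cvg_cst.
  rewrite -[X in _ --> X]subr0 -[in X in _ --> X]w_mean.
  apply: cvgB; first exact: cvg_cst.
  by rewrite (cvg_shiftS (fun n => iter n step w v)); apply: iter_step_cvg.
exact: cvg_subK Bc Bm.
Qed.

(** The deviation of [D n] from its mean stays bounded, hence is negligible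
    against [n.+1], and the increments of its mean converge. In their limit
    [mean l], the constant [K] disappears because [gc] has mean 0, and
    [Q f = f - gc] gives [gc ^+ 2 + 2 * gc * Q f = gc * (2 * f - gc)]. *)
Lemma moment2_cvg z :
  (fun n => D n z / n.+1%:R) @ \oo -->
  mean u * mean (fun v => gc v * (2 * f v - gc v)).
Proof.
pose K := mean (fun v => gc v * w v).
pose r n v := gc v ^+ 2 * A n.+1 v + 2 * gc v * step (B n) v.
pose l v := gc v ^+ 2 * mean u + 2 * gc v * (mean u * step f v + K).
have rl v : (fun n => r n v) @ \oo --> l v.
  apply: cvgD; apply: cvgM; do ?exact: cvg_cst.
    by rewrite (cvg_shiftS (fun n => A n v)); apply: weight_cvg.
  have -> : mean u * step f v + K = step (fun v' => mean u * f v' + K) v.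
    have -> : step (fun v' => mean u * f v' + K) v = step (fun v' => K + mean u * f v') v.
      by apply: eq_bigr => v' _; rewrite addrC.
    by rewrite step_lin step_cst addrC.
  apply: cvg_sum_fin => v'; apply: cvgM; first exact: cvg_cst.
  exact: moment1_cvg.
have ml : mean l = mean u * mean (fun v => gc v * (2 * f v - gc v)).
  have -> : mean l = mean (fun v => mean u * (gc v * (2 * f v - gc v)) + 2 * K * gc v).
    by apply: eq_bigr => v _; congr (_ * _); rewrite /l -f_poisson; ring.
  by rewrite mean_lin meanZ gc_mean mulr0 addr0.
have [F F0 FP] : exists2 F, mean F = 0 & forall v, F v - step F v = l v - mean l.
  apply: poisson_exists.
  have -> : mean (fun v => l v - mean l) = mean (fun v => - mean l + 1 * l v).
    by apply: eq_bigr => v _; congr (_ * _); ring.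
  by rewrite mean_lin mean_cst; ring.
have DS' n v : D n.+1 v = step (D n) v + r n v by rewrite DS addrC.
have Dc : (fun n => D n z - mean (D n)) @ \oo --> F z by apply: (forced_cvg DS' rl).
have mD n : mean (D n.+1) = mean (D n) + mean (r n).
  have -> : mean (D n.+1) = mean (fun v => step (D n) v + 1 * r n v).
    by apply: eq_bigr => v _; rewrite DS' mul1r.
  by rewrite mean_lin mean_step mul1r.
have Dm := cesaro_increments mD (cvg_mean rl).
have inv0 : (fun n => n.+1%:R^-1) @ \oo --> (0 : R) by apply: cvg_harmonic.
rewrite -ml -[mean l]add0r -(mulr0 (F z)); apply: (cvg_subK _ Dm).
by under eq_fun do rewrite -mulrBl; apply: cvgM.
Qed.

End AdditiveFunctional.

Lemma step_variance f z :
  step (fun v => f v ^+ 2) z - step f z ^+ 2 = step (fun v => (f v - step f z) ^+ 2) z.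
Proof.
set a := step f z.
have -> : step (fun v => (f v - a) ^+ 2) z =
          step (fun v => f v ^+ 2 + (- (2 * a)) * f v + 1 * a ^+ 2) z.
  by apply: eq_bigr => v _; congr (_ * _); ring.
by rewrite !step_lin step_cst -/a; ring.
Qed.

(** By stationarity, [gc * (2 * f - gc) = f ^+ 2 - (Q f) ^+ 2] has the same mean
    as the conditional variance [Q (f ^+ 2) - (Q f) ^+ 2]; the bound keeps one
    term of this mean, the loop at [z]. *)
Lemma variance_ge gc f z : (forall v, f v - step f v = gc v) ->
  pi z * Q z z * gc z ^+ 2 <= mean (fun v => gc v * (2 * f v - gc v)).
Proof.
move=> pf.
have -> : mean (fun v => gc v * (2 * f v - gc v)) =
          mean (fun v => step (fun v' => (f v' - step f v) ^+ 2) v).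
  have -> : mean (fun v => gc v * (2 * f v - gc v)) =
            mean (fun v => f v ^+ 2 + -1 * step f v ^+ 2).
    by apply: eq_bigr => v _; congr (_ * _); rewrite -pf; ring.
  rewrite mean_lin -(mean_step (fun v => f v ^+ 2)) -mean_lin.
  by apply: eq_bigr => v _; rewrite mulN1r step_variance.
rewrite /mean (bigD1 z) //=; apply: ler_wpDr.
  apply: sumr_ge0 => v _; rewrite mulr_ge0 //.
  by apply: step_ge0 => v'; apply: sqr_ge0.
rewrite -mulrA ler_wpM2l // -pf; set a := step f z.
rewrite /step (bigD1 z) //=; apply: ler_wpDr => //.
by apply: sumr_ge0 => v _; rewrite mulr_ge0 // sqr_ge0.
Qed.

End FiniteMarkovChain.

(** * The chain of the Perron eigenvector *)
Section PerronChain.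
Context (R : realType) (L : nat) (c : nat -> nat) (adm : admissible L c).
Context (lambda : R) (nu phi : calL L c -> R) (hP : perron_data lambda nu phi).
Local Notation S := (calL L c).
Local Notation Q := (Qmx lambda phi).
Local Notation pi := (piQ nu phi).
Local Notation step := (step Q).
Local Notation mean := (mean pi).
Implicit Types (z : S) (h f : S -> R).

Definition PL_denominator : R := ((max_coef L c).+1 * L)%N%:R.

Lemma PL_denominator_gt0 : 0 < PL_denominator.
Proof. by rewrite ltr0n muln_gt0 (L_gt0 adm). Qed.

Lemma lambda_gt0 : 0 < lambda. Proof. by case: hP => -[]. Qed.
Lemma phi_gt0 z : 0 < phi z. Proof. by case: hP => _ [_]. Qed.
Lemma nu_gt0 z : 0 < nu z. Proof. by case: hP => _ []. Qed.

Lemma Qmx_ge0 z z' : 0 <= Q z z'.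
Proof.
have inv0 (a : R) : 0 < a -> 0 <= a^-1 by move=> a0; rewrite invr_ge0 ltW.
rewrite /Qmx /PL; apply: mulr_ge0; last exact/ltW/phi_gt0.
apply: mulr_ge0; first by apply/inv0/mulr_gt0; rewrite ?lambda_gt0 ?phi_gt0.
by case: ifP => // _; apply: inv0 PL_denominator_gt0.
Qed.

Lemma Qmx_gt0 z z' : target z = source z' -> 0 < Q z z'.
Proof.
move=> tz; rewrite /Qmx /PL tz eqxx.
by rewrite !mulr_gt0 ?invr_gt0 ?mulr_gt0 ?lambda_gt0 ?phi_gt0 // PL_denominator_gt0.
Qed.

Lemma Qmx_sum1 z : \sum_z' Q z z' = 1.
Proof.
have [_ _ _ hphi _] := hP; rewrite /Qmx; under eq_bigr do rewrite -mulrA.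
rewrite -mulr_sumr hphi mulVf // mulf_neq0 // gt_eqF ?lambda_gt0 ?phi_gt0 //.
Qed.

Lemma piQ_stationary z' : \sum_z pi z * Q z z' = pi z'.
Proof.
have [_ _ hnu _ _] := hP; rewrite /piQ /Qmx.
transitivity ((\sum_z nu z * PL R z z') * (lambda^-1 * phi z')).
  rewrite mulr_suml; apply: eq_bigr => z _.
  by field; rewrite !gt_eqF ?lambda_gt0 ?phi_gt0.
by rewrite hnu; field; rewrite gt_eqF ?lambda_gt0.
Qed.

Lemma step_ge_edge : exists2 e : R, 0 < e &
  forall h, (forall z, 0 <= h z) ->
  forall z z', target z = source z' -> e * h z' <= step h z.
Proof.
exists (\big[Num.min/1]_(p : S * S | target p.1 == source p.2) Q p.1 p.2).
  by apply/lt_bigmin => // p /eqP; apply: Qmx_gt0.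
move=> h h0 z z' zz'.
apply: (@le_trans _ _ (Q z z' * h z')).
  rewrite ler_wpM2r //.
  by apply: (@bigmin_le_cond _ _ _ _ (z, z')); rewrite /= zz'.
rewrite /step (bigD1 z') //= lerDl sumr_ge0 // => v _.
by rewrite mulr_ge0 ?Qmx_ge0.
Qed.

(** From a target [t > 1], the maximal digits lead to the index [L], where
    the digit 0 leads back to index 1 because [c L > 0]; the loop at
    [zero_state] then fills up any number of steps. *)
Lemma perron_chain : exists z0 m delta,
  [/\ minorized_chain Q pi z0 m delta, digit z0 = 0%N & target z0 = source z0].
Proof.
have [z0 [d0 s0 t0]] := zero_state adm.
have [e e0 edge] := step_ge_edge.
(* The second alternative says that [L + 1 - target z] steps to a state of
   target 1, and one more step into [z0], fit in [k.+1] steps. *)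
have reach k z h : (forall v, 0 <= h v) ->
    (target z == 1%N) || (L.+1 < target z + k.+1)%N ->
    e ^+ k.+1 * h z0 <= iter k.+1 step h z.
  move=> h0; elim: k z => [|k IH] z.
    have /andP[_ tL] := target_bound adm z.
    case/orP=> [/eqP tz|]; last by rewrite addn1; lia.
    by rewrite expr1 /=; apply: edge => //; rewrite tz s0.
  move=> tzk; have [z' [tz tz']] : exists z' : S, target z = source z' /\
      (target z' == 1%N) || (L.+1 < target z' + k.+1)%N.
    have [t1|t1] := eqVneq (target z) 1%N; first by exists z0; rewrite t0 s0.
    have tL := target_bound adm z.
    have [tltL|Lt] := ltnP (target z) L.
      have [|z' [dz' sz']] := @state_exists L c (c (target z)) _ tL.
        by rewrite tltL addn1.
      exists z'; split => //; have [_ _ ->] := stateP z'.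
      by rewrite dz' sz' ltnn; move: tzk t1; lia.
    have tE : target z = L by lia.
    have [|z' [dz' sz']] := @state_exists L c 0 _ tL.
      by rewrite tE ltn_addr // (cL_gt0 adm).
    exists z'; split => //; have [_ _ ->] := stateP z'.
    by rewrite dz' sz' tE (cL_gt0 adm).
  have IHz' := IH _ tz'.
  rewrite exprS -mulrA iterS.
  have h0' v : 0 <= iter k.+1 step h v.
    elim: (k.+1) v => //= n IHn v.
    by apply: sumr_ge0 => v' _; rewrite mulr_ge0 ?Qmx_ge0.
  apply: (le_trans _ (edge _ h0' _ _ tz)).
  by apply: ler_wpM2l => //; apply: ltW.
exists z0, L.+1, (e ^+ L.+1); split => //; last by rewrite t0.
split.
- exact: Qmx_ge0.
- exact: Qmx_sum1.
- by move=> z; rewrite mulr_ge0 ?ltW ?nu_gt0 ?phi_gt0.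
- by case: hP => _ _ _ _ [].
- exact: piQ_stationary.
- by [].
- by rewrite exprn_gt0.
- move=> h h0 z; apply: reach => //.
  by have := target_bound adm z; lia.
Qed.

(** The pseudo-inverse is an inverse here: by [poisson_unique], [I - Q] is
    injective on the functions of mean 0, and by [poisson_exists] the centered
    [h] is in its image. *)
Lemma Qsharp_poisson h :
  mean (Qsharp lambda nu phi h) = 0 /\
  forall z, Qsharp lambda nu phi h z - step (Qsharp lambda nu phi h) z = h z - mean h.
Proof.
have [z0 [m [delta [chain _ _]]]] := perron_chain.
have [f mf pf] : exists2 f, mean f = 0 & forall z, f z - step f z = h z - mean h.
  apply: (poisson_exists chain).
  have -> : mean (fun z => h z - mean h) = mean (fun z => - mean h + 1 * h z).
    by apply: eq_bigr => v _; congr (_ * _); ring.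
  by rewrite mean_lin (mean_cst chain); ring.
suff -> : Qsharp lambda nu phi h = f by [].
rewrite /Qsharp -[X in 'pinv_(_) _ _ X](_ : IminusQ lambda phi f = _); last first.
  by apply/funext => z; apply: pf.
apply: pinvKV; last by rewrite inE.
move=> f1 f2; rewrite !inE => m1 m2 f12.
apply: (poisson_unique chain); first by rewrite [LHS]m1 [RHS]m2.
by move=> z; have := congr1 (fun k => k z) f12.
Qed.

Lemma mean_g_C_Lek : mean (@g R L c) = C_Lek nu phi.
Proof.
have [_ _ _ _ [_ pi1]] := hP.
rewrite /C_Lek /piQ1 -pi1 [in RHS](bigID (fun z => digit z == 0%N)) /=.
rewrite addrAC subrr add0r /mean (bigID (fun z => digit z == 0%N)) /=.
rewrite big1 ?add0r => [|z /eqP dz]; last by rewrite /g dz mulr0.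
by apply: eq_bigr => z; rewrite -lt0n /g => ->; rewrite mulr1.
Qed.

End PerronChain.

(** * Moments of the number of nonzero digits *)
Section DigitStatistics.
Context (R : realType) (L : nat) (c : nat -> nat) (adm : admissible L c).
Context (lambda : R) (nu phi : calL L c -> R) (hP : perron_data lambda nu phi).
Local Notation S := (calL L c).
Local Notation step := (step (Qmx lambda phi)).
Local Notation mean := (mean (piQ nu phi)).
Local Notation gc := (g_tilde nu phi).
Implicit Types (z : S) (Phi Psi : seq nat -> R).

Definition centered_count (s : seq nat) : R :=
  \sum_(x <- s) ((if (0 < x)%N then 1 else 0) - C_Lek nu phi).

Lemma g_tildeE z : gc z = g R z - C_Lek nu phi.
Proof. by rewrite -(mean_g_C_Lek hP). Qed.

Lemma centered_count_cons z s :
  centered_count (digit z :: s) = gc z + centered_count s.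
Proof. by rewrite /centered_count big_cons g_tildeE. Qed.

Lemma centered_countE s :
  centered_count s = (count (fun x => 0 < x)%N s)%:R - C_Lek nu phi * (size s)%:R.
Proof.
rewrite /centered_count; elim: s => [|x s IH] /=.
  by rewrite big_nil mulr0 subrr.
by rewrite big_cons IH natrD -[(size s).+1]addn1 natrD; case: (0 < x)%N => /=; ring.
Qed.

(** The number of paths from [z] grows like this denominator. Dividing by it
    is Doob's transform of the path-counting matrix by [phi]: it turns the
    sum over the successors of [z] into an average under [Qmx]. *)
Definition normalized_sum Phi n z : R :=
  path_sum n z Phi / ((PL_denominator R L c * lambda) ^+ n * phi z).

Lemma step_normalized Phi n z :
  step (normalized_sum Phi n) z =
  (\sum_(z' : S | source z' == target z) path_sum n z' Phi) /
    ((PL_denominator R L c * lambda) ^+ n.+1 * phi z).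
Proof.
rewrite /step mulr_suml [RHS]big_mkcond /=; apply: eq_bigr => z' _.
rewrite /normalized_sum /Qmx /PL -/(PL_denominator R L c) eq_sym.
case: ifP => _; last by rewrite !mulr0 !mul0r.
have l0 := lambda_gt0 hP; have p0 := phi_gt0 hP.
move: (PL_denominator R L c) (PL_denominator_gt0 R adm) => sc s0.
rewrite exprS; have : (sc * lambda) ^+ n != 0.
  by rewrite expf_neq0 // mulf_neq0 ?gt_eqF.
by move: (_ ^+ n) => K K0; field; rewrite K0 !gt_eqF.
Qed.

Lemma normalized_lin (a b : R) Phi Psi n z :
  normalized_sum (fun s => a * Phi s + b * Psi s) n z =
  a * normalized_sum Phi n z + b * normalized_sum Psi n z.
Proof. by rewrite /normalized_sum path_sum_lin mulrDl !mulrA. Qed.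

Lemma normalized_sumS Phi n z :
  normalized_sum Phi n.+1 z = step (normalized_sum (fun s => Phi (digit z :: s)) n) z.
Proof. by rewrite step_normalized. Qed.

Local Notation A := (normalized_sum (fun=> 1)).
Local Notation B := (normalized_sum centered_count).
Local Notation D := (normalized_sum (fun s => centered_count s ^+ 2)).

Lemma count_sum0 : A 0%N = (fun z => (phi z)^-1).
Proof. by apply/funext => z; rewrite /normalized_sum /= expr0 !mul1r. Qed.

Lemma first_moment0 z : B 0%N z = gc z * (phi z)^-1.
Proof.
by rewrite /normalized_sum /= centered_count_cons /centered_count big_nil addr0 expr0 mul1r.
Qed.

Lemma first_momentS n z : B n.+1 z = gc z * A n.+1 z + step (B n) z.
Proof.
rewrite !normalized_sumS -stepZ -[X in _ + X]mul1r -step_lin.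
by apply: eq_bigr => z' _; rewrite -normalized_lin /normalized_sum; congr (_ * (_ / _));
  apply: path_sum_ext => s _; rewrite centered_count_cons; ring.
Qed.

Lemma second_momentS n z :
  D n.+1 z = gc z ^+ 2 * A n.+1 z + 2 * gc z * step (B n) z + step (D n) z.
Proof.
rewrite !normalized_sumS -stepZ -step_lin -[X in _ + X]mul1r -step_lin.
apply: eq_bigr => z' _; congr (_ * _); rewrite -normalized_lin.
rewrite -[X in X + _]mul1r -normalized_lin.
rewrite /normalized_sum; congr (_ / _); apply: path_sum_ext => s _.
by rewrite centered_count_cons; ring.
Qed.

Lemma mean_inv_phi : mean (fun z => (phi z)^-1) = norm1 nu.
Proof.
by apply: eq_bigr => z _; rewrite /piQ mulfK // gt_eqF // (phi_gt0 hP).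
Qed.

Lemma norm1_gt0 : 0 < norm1 nu.
Proof.
have [z0 _] := calL0_nonempty adm.
rewrite /norm1 (bigD1 z0) //= ltr_wpDr ?(nu_gt0 hP) //.
by apply: sumr_ge0 => z _; rewrite ltW // (nu_gt0 hP).
Qed.

Lemma sum_phi_calL0_gt0 : 0 < \sum_(z : S | in_calL0 z) phi z.
Proof.
have [z0 z0L] := calL0_nonempty adm.
rewrite (bigD1 z0) //= ltr_wpDr ?(phi_gt0 hP) //.
by apply: sumr_ge0 => z _; rewrite ltW // (phi_gt0 hP).
Qed.

Lemma mean_g_tilde : mean gc = 0.
Proof.
have [z0 [m [delta [chain _ _]]]] := perron_chain adm hP.
have -> : mean gc = mean (fun z => - C_Lek nu phi + 1 * @g R L c z).
  by apply: eq_bigr => z _; rewrite g_tildeE mul1r addrC.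
by rewrite mean_lin (mean_cst chain) (mean_g_C_Lek hP); ring.
Qed.

Lemma Qsharp_g_tilde : Qsharp lambda nu phi gc = Qsharp lambda nu phi (@g R L c).
Proof.
rewrite /Qsharp; congr ('pinv_(_) _ _ _); apply/funext => z.
by rewrite -[expect _ gc]/(mean gc) mean_g_tilde subr0.
Qed.

Lemma C_Lek_gt0 : 0 < C_Lek nu phi.
Proof.
have [z0 /andP[_ d0]] := calL0_nonempty adm.
have pi0 z : 0 < piQ nu phi z by rewrite mulr_gt0 ?(nu_gt0 hP) ?(phi_gt0 hP).
rewrite -(mean_g_C_Lek hP) /mean (bigD1 z0) //= {1}/g d0 mulr1 ltr_wpDr //.
by apply: sumr_ge0 => z _; rewrite /g; case: ifP; rewrite ?mulr1 ?mulr0 // ltW.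
Qed.

(** Bounded below by the contribution of the loop of digit 0, where [g_tilde]
    equals [- C_Lek]. *)
Lemma sigma2_gt0 : 0 < sigma2 lambda nu phi.
Proof.
have [z0 [m [delta [chain d0 t0]]]] := perron_chain adm hP.
have [_ pf] := Qsharp_poisson adm hP gc.
have pf' z : Qsharp lambda nu phi gc z - step (Qsharp lambda nu phi gc) z = gc z.
  by rewrite pf mean_g_tilde subr0.
apply: lt_le_trans (variance_ge chain z0 pf').
apply: mulr_gt0.
  apply: mulr_gt0; last exact: (Qmx_gt0 adm hP).
  by rewrite mulr_gt0 ?(nu_gt0 hP) ?(phi_gt0 hP).
by rewrite g_tildeE /g d0 /= sub0r sqrrN exprn_gt0 // C_Lek_gt0.
Qed.

Local Notation f := (Qsharp lambda nu phi (@g R L c)).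
Local Notation w := (Qsharp lambda nu phi (fun z => (phi z)^-1)).

Lemma count_sum_cvg z : (fun n => A n z) @ \oo --> norm1 nu.
Proof.
have [z0 [m [delta [chain _ _]]]] := perron_chain adm hP.
rewrite -mean_inv_phi; apply: (weight_cvg chain count_sum0).
by move=> n v; rewrite normalized_sumS.
Qed.

(** [w] has mean 0, so [g] may replace [g_tilde] in the constant. *)
Lemma first_moment_cvg z : (fun n => B n z) @ \oo -->
  norm1 nu * f z + mean (fun v => @g R L c v * w v).
Proof.
have [z0 [m [delta [chain _ _]]]] := perron_chain adm hP.
have [f0 pf] := Qsharp_poisson adm hP (@g R L c).
have [w0 pw] := Qsharp_poisson adm hP (fun z => (phi z)^-1).
have -> : mean (fun v => @g R L c v * w v) = mean (fun v => gc v * w v).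
  have -> : mean (fun v => gc v * w v) =
            mean (fun v => @g R L c v * w v + - C_Lek nu phi * w v).
    by apply: eq_bigr => v _; rewrite g_tildeE; congr (_ * _); ring.
  by rewrite mean_lin w0 mulr0 addr0.
rewrite -mean_inv_phi.
apply: (moment1_cvg chain count_sum0 _ first_moment0 first_momentS mean_g_tilde f0 _ w0 pw).
- by move=> n v; rewrite normalized_sumS.
- by move=> v; rewrite pf.
Qed.

Lemma second_moment_cvg z :
  (fun n => D n z / n.+1%:R) @ \oo --> norm1 nu * sigma2 lambda nu phi.
Proof.
have [z0 [m [delta [chain _ _]]]] := perron_chain adm hP.
have [f0 pf] := Qsharp_poisson adm hP (@g R L c).
have [w0 pw] := Qsharp_poisson adm hP (fun z => (phi z)^-1).
rewrite -mean_inv_phi /sigma2 Qsharp_g_tilde.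
apply: (moment2_cvg chain count_sum0 _ first_moment0 first_momentS second_momentS
          mean_g_tilde f0 _ w0 pw).
- by move=> n v; rewrite normalized_sumS.
- by move=> v; rewrite pf.
Qed.

(** The weights [phi z] come from the denominator of [normalized_sum]; after
    division by their total they form [phi_tilde phi]. *)
Lemma ratio_cvg (x : nat -> S -> R) (l : S -> R) :
  (forall z, (fun n => x n z) @ \oo --> l z) ->
  (fun n => (\sum_(z : S | in_calL0 z) phi z * x n z) /
            (\sum_(z : S | in_calL0 z) phi z * A n z)) @ \oo -->
  expect (phi_tilde phi) l / norm1 nu.
Proof.
move=> xl; set W := \sum_(z : S | in_calL0 z) phi z.
have sum_cvg (y : nat -> S -> R) (k : S -> R) :
    (forall z, (fun n => y n z) @ \oo --> k z) ->
    (fun n => \sum_(z : S | in_calL0 z) phi z * y n z) @ \oo -->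
    \sum_(z : S | in_calL0 z) phi z * k z.
  move=> yk; rewrite big_mkcond; under eq_fun do rewrite big_mkcond.
  apply: cvg_sum_fin => z; case: ifP => _; last exact: cvg_cst.
  by apply: cvgM => //; apply: cvg_cst.
have -> : expect (phi_tilde phi) l / norm1 nu =
          (\sum_(z : S | in_calL0 z) phi z * l z) /
          (\sum_(z : S | in_calL0 z) phi z * norm1 nu).
  have W0 := sum_phi_calL0_gt0; have n0 := norm1_gt0.
  rewrite -mulr_suml -/W invfM mulrA; congr (_ * _).
  rewrite /expect /phi_tilde mulr_suml [RHS]big_mkcond; apply: eq_bigr => z _.
  by case: ifP => _; rewrite ?mul0r // mulrAC.
apply: cvgM; first exact: sum_cvg.
apply: cvgV; last by apply: sum_cvg; apply: count_sum_cvg.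
by rewrite -mulr_suml mulf_neq0 ?gt_eqF ?sum_phi_calL0_gt0 ?norm1_gt0.
Qed.

Context (G : nat -> nat) (recG : positive_linear_recursion L c G).

Lemma EQ_normalized n (h : nat -> R) Phi :
  (forall N, (G n.+1 <= N < G n.+2)%N -> h N = Phi (legal_decomposition L c G N)) ->
  EQ G n h = (\sum_(z : S | in_calL0 z) phi z * normalized_sum Phi n z) /
             (\sum_(z : S | in_calL0 z) phi z * A n z).
Proof.
move=> hPhi; rewrite (EQ_path_sum adm recG hPhi).
set K := (PL_denominator R L c * lambda) ^+ n.
have K0 : K != 0 by rewrite expf_neq0 // mulf_neq0 ?gt_eqF ?PL_denominator_gt0 ?(lambda_gt0 hP).
have unnormalize Psi : \sum_(z : S | in_calL0 z) phi z * normalized_sum Psi n z =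
    (\sum_(z : S | in_calL0 z) path_sum n z Psi) / K.
  rewrite mulr_suml; apply: eq_bigr => z _; rewrite /normalized_sum -/K.
  by field; rewrite K0 gt_eqF // (phi_gt0 hP).
by rewrite !unnormalize -mulf_div divff ?invr_neq0 // mulr1.
Qed.

Lemma centered_count_legal n N : (G n.+1 <= N < G n.+2)%N ->
  (num_nonzero L c G N)%:R - C_Lek nu phi * n.+1%:R =
  centered_count (legal_decomposition L c G N).
Proof.
move=> NG; rewrite centered_countE /num_nonzero.
by rewrite {3}(legal_decompositionE adm recG NG) size_word_of.
Qed.

Lemma EQ_shift n (h : nat -> R) (a : R) : EQ G n (fun N => h N - a) = EQ G n h - a.
Proof.
have lt := block_nonempty adm recG n.
rewrite /EQ sumrB sumr_const_nat mulrBl -[a *+ _]mulr_natr mulfK //.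
by rewrite pnatr_eq0 subn_eq0 -ltnNge.
Qed.

End DigitStatistics.

Unset Implicit Arguments.

Theorem corollary3p4 (R : realType) (L : nat) (c G : nat -> nat)
    (hc : admissible L c) (hG : positive_linear_recursion L c G)
    (lambda : R) (nu phi : calL L c -> R)
    (hP : perron_data lambda nu phi) :
  ((fun n : nat =>
      EQ G n (fun N => (num_nonzero L c G N)%:R)
      - (C_Lek nu phi * n.+1%:R + d_Lek lambda nu phi)) @ \oo --> (0 : R))
  /\
  (exists2 eps : nat -> R, eps @ \oo --> (0 : R) &
    forall n : nat,
      EQ G n (fun N => ((num_nonzero L c G N)%:R - C_Lek nu phi * n.+1%:R) ^+ 2)
      = (1 + eps n) * n.+1%:R * sigma2 lambda nu phi).
Proof.
have N0 := norm1_gt0 hc hP; have s0 := sigma2_gt0 hc hP.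
have phi_tilde1 : \sum_z phi_tilde phi z = 1.
  rewrite /phi_tilde -big_mkcond /= -mulr_suml divff //.
  by rewrite gt_eqF // (sum_phi_calL0_gt0 hc hP).
split.
  (* The path weights are a probability, so the term C_Lek (n + 1) may be moved
     into the expectation; what is left has the limit d_Lek. *)
  have := ratio_cvg hc hP (first_moment_cvg hc hP); rewrite /expect.
  set K := mean _ _.
  have -> : (\sum_z phi_tilde phi z *
       (norm1 nu * Qsharp lambda nu phi (@g R L c) z + K)) / norm1 nu = d_Lek lambda nu phi.
    under eq_bigr do rewrite mulrDr mulrCA.
    rewrite big_split /= -mulr_sumr -mulr_suml phi_tilde1 mul1r mulrDl.
    by rewrite [norm1 nu * _]mulrC mulfK ?gt_eqF.
  move=> Bd; rewrite -(subrr (d_Lek lambda nu phi)).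
  rewrite (_ : (fun n => _) = fun n => (\sum_(z : calL L c | in_calL0 z) phi z *
      normalized_sum lambda phi (centered_count nu phi) n z) /
      (\sum_(z : calL L c | in_calL0 z) phi z *
      normalized_sum lambda phi (fun=> 1) n z) - d_Lek lambda nu phi).
    by apply: cvgB => //; apply: cvg_cst.
  apply/funext => n; rewrite opprD addrA -(EQ_shift hc hG); congr (_ - _).
  by apply: (EQ_normalized hc hP hG) => N NG; rewrite (centered_count_legal hc _ _ hG NG).
pose E2 n := EQ G n (fun N => ((num_nonzero L c G N)%:R - C_Lek nu phi * n.+1%:R) ^+ 2).
exists (fun n => E2 n / n.+1%:R / sigma2 lambda nu phi - 1); last first.
  move=> n; rewrite -/(E2 n) [1 + _]addrC subrK mulrAC divfK ?gt_eqF //.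
  by rewrite divfK // pnatr_eq0.
have := ratio_cvg hc hP (second_moment_cvg hc hP).
rewrite /expect -mulr_suml phi_tilde1 mul1r [norm1 nu * _]mulrC mulfK ?gt_eqF // => Dc.
suff E2c : (fun n => E2 n / n.+1%:R) @ \oo --> sigma2 lambda nu phi.
  suff : (fun n => E2 n / n.+1%:R / sigma2 lambda nu phi - 1) @ \oo -->
      sigma2 lambda nu phi / sigma2 lambda nu phi - 1 by rewrite divff ?subrr ?gt_eqF.
  by apply: cvgB; [apply: cvgM => // |]; apply: cvg_cst.
rewrite (_ : (fun n => _) = fun n => (\sum_(z : calL L c | in_calL0 z) phi z *
      (normalized_sum lambda phi (fun s => centered_count nu phi s ^+ 2) n z / n.+1%:R)) /
      (\sum_(z : calL L c | in_calL0 z) phi z *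
      normalized_sum lambda phi (fun=> 1) n z)) //.
apply/funext => n; rewrite /E2.
rewrite (EQ_normalized hc hP hG (Phi := fun s => centered_count nu phi s ^+ 2)); last first.
  by move=> N NG; rewrite (centered_count_legal hc _ _ hG NG).
rewrite mulrAC; congr (_ / _); rewrite mulr_suml.
by apply: eq_bigr => z _; rewrite -mulrA.
Qed.
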